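(* Let $(V,\mu)$ and $(E,\tau)$ be positive measure spaces, $M:V\times E\to\mathbb R$ a $(\mu\times\tau)$-measurable function, $wt:E\to\mathbb R$ a $\tau$-measurable function, $I\subseteq\mathbb R$ an interval, and $\varphi:I\to\mathbb R$ a function such that $f(t)=t\varphi(t)$ is convex on $I$. Suppose that: (i) $0<\mu(V)<\infty$; (ii) $0<s=\int_E wt\,d\tau<\infty$; (iii) $\int_{V\times E}|M(v,e)|\,|wt(e)|\,d(\mu\times\tau)<\infty$; (iv) for some real number $c$, $\int_V M(v,e)\,d\mu(v)=c$ for $\tau$-almost all $e\in E$, and $\delta(v)=\int_E M(v,e)\,wt(e)\,d\tau(e)\in I$ for $\mu$-almost all $v\in V$; (v) $\int_{V\times E}|\varphi(\delta(v))|\,|M(v,e)|\,|wt(e)|\,d(\mu\times\tau)<\infty$. Assume in addition that $\mu(V)=1$ and $cs=1$, and that $\delta(v)\ge 0$ for $\mu$-almost every $v\in V$. Then, for every $p\ge 1$, \[ \int_V\delta(v)^p\,d\mu(v)\ge 1 . \] If $p>1$, equality holds if and only if $\delta(v)=1$ for $\mu$-almost every $v\in V$.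
   Context: A positive measure space is a measure space equipped with a positive measure, and $\mu\times\tau$ is the product measure on $V\times E$. All functions and kernels are assumed measurable whenever required, and all stated integrals are assumed to be well defined. *)

(* Defs.v *)
From mathcomp Require Import all_boot all_order all_algebra.
From mathcomp Require Import all_classical all_reals all_analysis.

Set Implicit Arguments.
Unset Strict Implicit.
Unset Printing Implicit Defensive.

Import Order.TTheory GRing.Theory Num.Theory.
Import numFieldNormedType.Exports.

Local Open Scope classical_set_scope.
Local Open Scope ring_scope.

(* Neither factor is assumed sigma-finite, so a product measure need not be
   unique.  The library's [mu \x tau] (resp. [mu \x^ tau]) satisfies this
   predicate when [tau] (resp. [mu]) is sigma-finite, and is the only measure
   that does when both are. *)
Definition is_product_measure (dV dE : measure_display) (V : measurableType dV)
    (E : measurableType dE) (R : realType) (mu : {measure set V -> \bar R})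
    (tau : {measure set E -> \bar R})
    (pi : {measure set (V * E)%type -> \bar R}) : Prop :=
  forall (A : set V) (B : set E), measurable A -> measurable B ->
    pi (A `*` B) = (mu A * tau B)%E.

(* [\int] in [ring_scope] is [Rintegral], which is 0 when the integral is
   infinite or undefined.  This convention only affects a null set of [v] when
   [M (v, e) * wt e] is integrable for almost every [v]. *)
Definition delta (dV dE : measure_display) (V : measurableType dV)
    (E : measurableType dE) (R : realType) (tau : {measure set E -> \bar R})
    (M : V * E -> R) (wt : E -> R) (v : V) : R :=
  \int[tau]_e (M (v, e) * wt e).

(* Main.v *)
Require Import Defs.
From HB Require Import structures.
From mathcomp Require Import all_boot all_order all_algebra.
From mathcomp Require Import all_classical all_reals all_analysis.
From mathcomp Require Import measurable_realfun ring lra.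
Import Order.TTheory GRing.Theory Num.Theory.
Import numFieldNormedType.Exports.
Local Open Scope classical_set_scope.
Local Open Scope ring_scope.

(* Since [wt] is integrable, [tau] is sigma-finite on [W = {wt != 0}], and [pi]
   restricted to [V * W] is the unique product measure there; every integrand
   carries a factor [wt], so Fubini applies and gives
   [\int delta dmu = \int wt(e) (\int M(v, e) dmu(v)) dtau(e) = c s = 1].
   Integrating the tangent line inequality [x `^ p >= 1 + p (x - 1)] at
   [x = delta v] then gives the bound, and since the inequality is strict for
   [p > 1] and [x != 1], equality forces [delta = 1] almost everywhere. *)

(** * Tangent line inequality for real powers at 1 *)

Lemma powR_gt_tangent (R : realType) (p x : R) :
  1 < p -> 0 <= x -> x != 1 -> 1 + p * (x - 1) < x `^ p.
Proof.
move=> p1; rewrite le_eqVlt => /orP[/eqP <- _|x0 x1].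
  by rewrite powR0 ?gt_eqF//; lra.
(* With [u = ln x], [x `^ p = x * expR ((p - 1) * u) >= x * (1 + (p - 1) * u)],
   and [expR (- u) > 1 - u] concludes. *)
have u0 : ln x != 0 by rewrite ln_eq0.
have : 1 - ln x < expR (- ln x) by rewrite expR_gt1Dx ?oppr_eq0.
have : 1 + (p - 1) * ln x <= expR ((p - 1) * ln x) by exact: expR_ge1Dx.
rewrite /powR gt_eqF// (_ : p * ln x = ln x + (p - 1) * ln x); last by ring.
rewrite expRD lnK ?posrE// expRN lnK ?posrE//.
set u := ln x => hp hx.
apply: (@lt_le_trans _ _ (x * (1 + (p - 1) * u))); last by rewrite ler_pM2l.
have : x * (1 - u) < 1 by rewrite -(ltr_pM2l x0) mulfV ?gt_eqF// in hx.
nra.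
Qed.

Lemma powR_ge_tangent (R : realType) (p x : R) :
  1 <= p -> 0 <= x -> 1 + p * (x - 1) <= x `^ p.
Proof.
rewrite le_eqVlt => /orP[/eqP <- x0|p1 x0]; first by rewrite powRr1//; lra.
have [->|x1] := eqVneq x 1; first by rewrite powR1; lra.
exact/ltW/powR_gt_tangent.
Qed.

(** * Restriction of a measure to the support of a function *)

Lemma integral_mrestr_support {d : measure_display} {T : measurableType d}
    {R : realType} (mu : {measure set T -> \bar R}) (D : set T)
    (mD : measurable D) (f : T -> \bar R) :
  (forall x, ~ D x -> f x = 0%E) ->
  (\int[mrestr mu mD]_x f x = \int[mu]_x f x)%E.
Proof.
move=> f0; have fD : f \_ D = f.
  apply/funext => x; rewrite patchE; case: ifPn => //.
  by rewrite notin_setE => /f0 ->.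
rewrite -fD -2!integral_mkcond; apply: eq_measure_integral => A mA AD.
by rewrite /= /mrestr setIidl.
Qed.

(** The complement of the support is null for the restricted measure, and Markov's inequality bounds
    [mu] on each level set [1 / (n + 1) <= |g|]; these level sets exhaust the support. *)
Lemma sigma_finite_mrestr_support {d : measure_display} {T : measurableType d}
    {R : realType} (mu : {measure set T -> \bar R}) (g : T -> R)
    (mW : measurable [set x | g x != 0]) :
  mu.-integrable setT (EFin \o g) -> sigma_finite setT (mrestr mu mW).
Proof.
move=> /integrableP[mg ig].
pose L (n : nat) := [set x | (n.+1%:R^-1%:E <= `|(EFin \o g) x|)%E].
have mL n : measurable (L n).
  rewrite -(setTI (L n)); apply: emeasurable_fun_c_infty => //.
  exact: measurableT_comp.
exists (fun n => ~` [set x | g x != 0] `|` L n).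
  apply/esym; rewrite -subTset => x _.
  have [gx0|gx0] := eqVneq (g x) 0; first by exists 0%N => //; left; rewrite /= gx0 eqxx.
  have [n ngx] : exists n : nat, n.+1%:R^-1 <= `|g x|.
    exists (Num.bound (`|g x|^-1)).
    have gi0 : 0 <= `|g x|^-1 by rewrite invr_ge0.
    rewrite invf_ple ?posrE ?normr_gt0// (le_trans (ltW (archi_boundP gi0)))//.
    by rewrite ler_nat.
  by exists n => //; right; rewrite /L /= lee_fin.
move=> n; split; first by apply: measurableU => //; exact: measurableC.
rewrite /mrestr setIUl setICl set0U.
apply: (@le_lt_trans _ _ (mu (L n))).
  by apply: le_measure; rewrite ?inE//; exact: measurableI.
have n0 : 0 < n.+1%:R^-1 :> R by rewrite invr_gt0.
have := le_integral_abse mu measurableT mg n0; rewrite setTI => h.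
have := le_lt_trans h ig; rewrite -/(L n).
(* An infinite [mu (L n)] would make the left side of Markov's bound infinite. *)
by case: (mu (L n)) => [r||]//; rewrite ?ltry// gt0_muley ?lte_fin.
Qed.

(** * Fubini for a measure with the product property *)

Section sigma_finite_copy.
Context {d : measure_display} {T : measurableType d} {R : realType}.
Variables (mu : {measure set T -> \bar R}) (smu : sigma_finite setT mu).

(* The vacuous [let] keeps the proof [smu] available to instance resolution. *)
Definition sigma_finite_copy : set T -> \bar R := let _ := smu in mu.

HB.instance Definition _ := Measure.copy sigma_finite_copy mu.

HB.instance Definition _ :=
  Measure_isSigmaFinite.Build _ _ _ sigma_finite_copy smu.

End sigma_finite_copy.

Section product_fubini.
Context {dV dE : measure_display} {V : measurableType dV}
  {E : measurableType dE} {R : realType}.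

(** On sigma-finite factors the product property determines the measure, so [pi] integrates like
    [m1 \x m2] and the usual Fubini theorem transfers. *)
Lemma is_product_measure_fubini (m1 : {sigma_finite_measure set V -> \bar R})
    (m2 : {sigma_finite_measure set E -> \bar R})
    (pi : {measure set (V * E)%type -> \bar R}) (f : V * E -> \bar R) :
  is_product_measure m1 m2 pi -> pi.-integrable setT f ->
  [/\ m1.-integrable setT (fun v => \int[m2]_e f (v, e))%E,
      measurable_fun setT (fun e => \int[m1]_v f (v, e))%E &
      \int[m1]_v \int[m2]_e f (v, e) = \int[m2]_e \int[m1]_v f (v, e)]%E.
Proof.
move=> hpi /integrableP[mf fi].
have imf : (m1 \x m2)%E.-integrable setT f.
  apply/integrableP; split => //; apply: le_lt_trans fi.
  rewrite le_eqVlt; apply/orP; left; apply/eqP.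
  apply: eq_measure_integral => A mA _.
  exact: product_measure_unique.
split; [exact: integrable_fubini_F imf| |exact: Fubini].
exact: measurable_fubini_G imf.
Qed.

(** Only [mu] is sigma-finite here; [tau] becomes so once restricted to the support of [g]. As [f]
    vanishes where [g] does, restricting [tau] and [pi] changes none of the integrals. *)
Lemma is_product_measure_fubini_support
    (mu : {measure set V -> \bar R}) (tau : {measure set E -> \bar R})
    (pi : {measure set (V * E)%type -> \bar R}) (g : E -> R)
    (f : V * E -> \bar R) :
  sigma_finite setT mu -> is_product_measure mu tau pi ->
  tau.-integrable setT (EFin \o g) ->
  (forall v e, g e = 0 -> f (v, e) = 0%E) -> pi.-integrable setT f ->
  [/\ mu.-integrable setT (fun v => \int[tau]_e f (v, e))%E,
      measurable_fun setT (fun e => \int[mu]_v f (v, e))%E &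
      \int[mu]_v \int[tau]_e f (v, e) = \int[tau]_e \int[mu]_v f (v, e)]%E.
Proof.
move=> smu hpi ig f0 /integrableP[mf fi].
have mW : measurable [set e | g e != 0].
  have /measurable_EFinP mg := measurable_int _ ig.
  rewrite (_ : [set _ | _] = setT `&` g @^-1` (~` [set 0])).
    by apply: mg => //; exact: measurableC.
  by rewrite setTI; apply/seteqP; split => e /= /eqP.
have mVW : measurable (setT `*` [set e | g e != 0] : set (V * E)).
  exact: measurableX.
pose tauW := sigma_finite_copy (mrestr tau mW)
  (sigma_finite_mrestr_support tau g mW ig).
have tauWE (h : E -> \bar R) : (forall e, g e = 0 -> h e = 0%E) ->
    (\int[tauW]_e h e = \int[tau]_e h e)%E.
  move=> h0; apply: integral_mrestr_support => e /= /negP.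
  by rewrite negbK => /eqP /h0.
(* Cutting a rectangle by the strip over the support only shrinks its second side, so the product
   property survives. *)
have piW : is_product_measure mu tauW (mrestr pi mVW).
  move=> A B mA mB; rewrite /= /mrestr -setXI setIT hpi//.
  exact: measurableI.
have ifW : (mrestr pi mVW).-integrable setT f.
  apply/integrableP; split => //.
  rewrite (integral_mrestr_support pi _ mVW)// => -[v e] /= nW.
  rewrite f0 ?abse0//; apply/eqP; rewrite -[_ == _]negbK; apply/negP => ge.
  by apply: nW.
have [] := is_product_measure_fubini (sigma_finite_copy mu smu) tauW _ f piW ifW.
rewrite (_ : (fun v => \int[tauW]_e f (v, e))%E =
    (fun v => \int[tau]_e f (v, e))%E); last first.
  by apply/funext => v; rewrite tauWE// => e; exact: f0.
move=> i1 mG i2; split => //.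
(* The integral over [V] also vanishes where [g] does, so the outer one may run over [tauW] as well
   as [tau]. *)
rewrite -[RHS]tauWE; first exact: i2.
by move=> e ge0; rewrite integral0_eq// => v _; exact: f0.
Qed.

End product_fubini.

(** * Jensen's inequality for powers and its equality case *)

Section powR_jensen.
Context {d : measure_display} {T : measurableType d} {R : realType}.
Variables (mu : {measure set T -> \bar R}) (X : T -> R) (p : R).
Hypothesis mu1 : mu setT = 1%E.
Hypothesis iX : mu.-integrable setT (EFin \o X).
Hypothesis X0 : forall x, 0 <= X x.
Hypothesis EX : (\int[mu]_x (X x)%:E = 1)%E.

(** For [1 <= p] this excess is nonnegative; the sign of its integral gives the bound, and its
    vanishing the equality case. *)
Let gap x := X x `^ p - (1 + p * (X x - 1)).

Let mX : measurable_fun setT X.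
Proof. by apply/measurable_EFinP; exact: measurable_int iX. Qed.

Let mXp : measurable_fun setT (fun x => (X x `^ p)%:E).
Proof.
by apply/measurable_EFinP; exact: (measurableT_comp (measurable_powR p) mX).
Qed.

Let integrable_one : mu.-integrable setT (cst 1%E : T -> \bar R).
Proof.
apply/integrableP; split; first exact: measurable_cst.
by under eq_integral do rewrite /= normr1; rewrite integral_cst// mul1e mu1 ltry.
Qed.

Let tangentE : (fun x => (1 + p * (X x - 1))%:E) =
  (fun x => (1 - p)%:E * cst 1%E x + p%:E * (X x)%:E)%E.
Proof.
by apply/funext => x; rewrite /= -!EFinM -EFinD; congr EFin; ring.
Qed.

Let integrable_tangent :
  mu.-integrable setT (fun x => (1 + p * (X x - 1))%:E).
Proof. by rewrite tangentE; apply: integrableD => //; exact: integrableZl. Qed.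

(** Mass and mean are both 1, so the slope term integrates to 0. *)
Let integral_tangent : (\int[mu]_x (1 + p * (X x - 1))%:E = 1)%E.
Proof.
rewrite tangentE integralD//; [|exact: integrableZl|exact: integrableZl].
rewrite !integralZl// EX integral_cst// mu1 !mule1 -EFinD.
by congr EFin; ring.
Qed.

Let integrable_powR : (\int[mu]_x (X x `^ p)%:E < +oo)%E ->
  mu.-integrable setT (fun x => (X x `^ p)%:E).
Proof.
move=> fin; apply/integrableP; split => //.
by under eq_integral do rewrite gee0_abs ?lee_fin ?powR_ge0//.
Qed.

Let integral_gap : (\int[mu]_x (X x `^ p)%:E < +oo)%E ->
  (\int[mu]_x (gap x)%:E = \int[mu]_x (X x `^ p)%:E - 1)%E.
Proof.
move=> fin; rewrite /gap -[in RHS]integral_tangent -integralB//.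
exact: integrable_powR.
Qed.

Lemma integral_powR_ge1 : 1 <= p -> (1 <= \int[mu]_x (X x `^ p)%:E)%E.
Proof.
(* An infinite integral satisfies the bound trivially; a finite one lets the tangent be subtracted
   under the integral. *)
move=> p1; have [->|] := eqVneq (\int[mu]_x (X x `^ p)%:E)%E +oo%E.
  by rewrite leey.
rewrite -ltey => fin; rewrite -sube_ge0// -integral_gap//.
by apply: integral_ge0 => x _; rewrite lee_fin subr_ge0 powR_ge_tangent.
Qed.

Lemma integral_powR_eq1 : 1 < p ->
  (\int[mu]_x (X x `^ p)%:E = 1)%E -> {ae mu, forall x, X x = 1}.
Proof.
move=> p1 h; have := integral_gap; rewrite h ltry => /(_ isT).
rewrite subee// => gap0.
have gap_ge0 x : 0 <= gap x by rewrite subr_ge0 powR_ge_tangent// ltW.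
have mgap : measurable_fun setT (EFin \o gap).
  apply/measurable_EFinP; apply: measurable_funB; first exact/measurable_EFinP.
  by apply/measurable_EFinP; exact: measurable_int integrable_tangent.
have /(ae_eq_integral_abs mu measurableT mgap) :
    (\int[mu]_x `|(EFin \o gap) x| = 0)%E.
  by rewrite -[RHS]gap0; apply: eq_integral => x _; rewrite gee0_abs ?lee_fin.
apply: filterS => x /(_ I) /= [gx0]; apply/eqP; apply/negPn/negP => x1.
by have := powR_gt_tangent _ _ _ p1 (X0 x) x1; rewrite -subr_gt0 -/(gap x) gx0 ltxx.
Qed.

End powR_jensen.

Theorem proposition2p6 (R : realType) (dV dE : measure_display)
  (V : measurableType dV) (E : measurableType dE)
  (mu : {measure set V -> \bar R}) (tau : {measure set E -> \bar R})
  (pi : {measure set (V * E)%type -> \bar R})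
  (hpi : is_product_measure mu tau pi)
  (M : V * E -> R) (mM : measurable_fun [set: (V * E)%type] M)
  (wt : E -> R) (mwt : measurable_fun [set: E] wt)
  (I : set R) (hI : is_interval I)
  (* [phi] is total, but only its values on [I] matter: see (iv) *)
  (phi : R -> R) (hphi : @convex_function R R^o I (fun t : R => t * phi t))
  (* (i) *)
  (hmu : (0 < mu [set: V] < +oo)%E)
  (* (ii) a real value [s] makes [wt] integrable, as oo - oo = -oo in [\bar R] *)
  (s : R) (hs : (\int[tau]_e (wt e)%:E = s%:E)%E) (s_gt0 : 0 < s)
  (* (iii) *)
  (hMwt : (\int[pi]_x (`|M x| * `|wt x.2|)%:E < +oo)%E)
  (* (iv) *)
  (c : R) (hc : {ae tau, forall e : E, (\int[mu]_v (M (v, e))%:E = c%:E)%E})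
  (hdI : {ae mu, forall v : V, I (delta tau M wt v)})
  (* (v) *)
  (hphiMwt : (\int[pi]_x
      (`|phi (delta tau M wt x.1)| * `|M x| * `|wt x.2|)%:E < +oo)%E)
  (* additional assumptions *)
  (hmu1 : mu [set: V] = 1%E) (hcs : c * s = 1)
  (hd0 : {ae mu, forall v : V, 0 <= delta tau M wt v}) :
  forall p : R, 1 <= p ->
    (1 <= \int[mu]_v (delta tau M wt v `^ p)%:E)%E /\
    (1 < p ->
      ((\int[mu]_v (delta tau M wt v `^ p)%:E = 1)%E <->
       {ae mu, forall v : V, delta tau M wt v = 1})).
Proof.
have iwt : tau.-integrable setT (EFin \o wt).
  apply/integrableP; split; first exact/measurable_EFinP.
  by rewrite integral_fin_num_abs// hs.
have mMwt : measurable_fun setT (fun x : V * E => M x * wt x.2).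
  by apply: measurable_funM => //; exact: measurableT_comp.
have iMwt : pi.-integrable setT (fun x => (M x * wt x.2)%:E).
  apply/integrableP; split; first exact/measurable_EFinP.
  by under eq_integral do rewrite /= normrM.
have smu : sigma_finite setT mu.
  apply: fin_num_fun_sigma_finite; first by rewrite measure0 ltry.
  by apply: lty_fin_num_fun; rewrite hmu1 ltry.
have [iF mG intF] := is_product_measure_fubini_support
  mu tau pi wt _ smu hpi iwt
  (fun v e we0 => congr1 EFin (etrans (congr1 _ we0) (mulr0 _))) iMwt.
(* [delta] is [fine] of the extended integral; the two agree wherever the latter is finite, which by
   [iF] is almost everywhere. *)
have deltaE : ae_eq mu setT (EFin \o delta tau M wt)
    (fun v => \int[tau]_e (M (v, e) * wt e)%:E)%E.
  have := integrable_ae measurableT iF.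
  by apply: filterS => v /= /[apply] ?; rewrite /delta fineK.
have md : measurable_fun setT (delta tau M wt).
  apply: (@measurableT_comp _ _ _ _ _ _ fine) => //.
  exact: measurable_int iF.
have Ed : (\int[mu]_v (delta tau M wt v)%:E = 1)%E.
  rewrite (ae_eq_integral _ _ measurableT _ _ deltaE)//; last 2 first.
  - exact/measurable_EFinP.
  - exact: measurable_int iF.
  (* After the swap, the inner integral is [c * wt e] for almost every [e]. *)
  rewrite intF (ae_eq_integral (fun e => c%:E * (wt e)%:E)%E)//.
  - by rewrite integralZl// hs -EFinM hcs.
  - by apply: measurable_funeM; exact/measurable_EFinP.
  - apply: filterS hc => e hce _ /=.
    (* The real value [c] forces the section to be integrable, since oo - oo = -oo; this allows
       pulling [wt e] out. *)
    have iMe : mu.-integrable setT (fun v => (M (v, e))%:E).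
      have mMe : measurable_fun setT (fun v => M (v, e)).
        by apply: measurableT_comp mM _; exact: pair2_measurable.
      apply/integrableP; split; first exact/measurable_EFinP.
      by rewrite integral_fin_num_abs// hce.
    by under eq_integral do rewrite EFinM; rewrite integralZr// hce.
(* [delta] is nonnegative only almost everywhere; its absolute value is a version that is so
   everywhere, as the lemmas on powers require. *)
pose X v := `|delta tau M wt v|.
have dX : {ae mu, forall v, delta tau M wt v = X v}.
  by apply: filterS hd0 => v d0; rewrite /X ger0_norm.
have mX : measurable_fun setT X by exact: measurableT_comp.
have iX : mu.-integrable setT (EFin \o X).
  have /integrableP[_ id] : mu.-integrable setT (EFin \o delta tau M wt).
    apply/integrableP; split; first exact/measurable_EFinP.
    by rewrite integral_fin_num_abs// Ed.
  apply/integrableP; split; first exact/measurable_EFinP.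
  by under eq_integral do rewrite /= normr_id.
have EX : (\int[mu]_v (X v)%:E = 1)%E.
  rewrite -Ed; apply: ae_eq_integral => //; try exact/measurable_EFinP.
  by apply: filterS dX => v <-.
move=> p p1.
have -> : (\int[mu]_v (delta tau M wt v `^ p)%:E = \int[mu]_v (X v `^ p)%:E)%E.
  apply: ae_eq_integral => //; last by apply: filterS dX => v ->.
  - by apply/measurable_EFinP; exact: (measurableT_comp (measurable_powR p) md).
  - by apply/measurable_EFinP; exact: (measurableT_comp (measurable_powR p) mX).
have X0 v : 0 <= X v by exact: normr_ge0.
split; first exact: integral_powR_ge1.
move=> p1'; split => [/(integral_powR_eq1 mu X p hmu1 iX X0 EX p1') X1|d1].
  by apply: filterS2 dX X1 => v ->.
rewrite (ae_eq_integral (cst 1%E))//; first by rewrite integral_cst// hmu1 mule1.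
  by apply/measurable_EFinP; exact: (measurableT_comp (measurable_powR p) mX).
by apply: filterS d1 => v d1 _ /=; rewrite /X d1 normr1 powR1.
Qed.
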